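(* Let $I\subset\mathbb{R}$ be an interval and let $M,N\colon I^2\to I$ be two means. For $x,y\in I$ define $x_0=x$, $y_0=y$, and $x_{n+1}=M(x_n,y_n)$, $y_{n+1}=N(x_n,y_n)$ for all integers $n\ge 0$. Define $$\mathscr{L}(x,y):=\lim_{n\to\infty}\min(x_n,y_n),\qquad \mathscr{U}(x,y):=\lim_{n\to\infty}\max(x_n,y_n)\qquad (x,y\in I).$$ Then $\mathscr{L}$ and $\mathscr{U}$ are $(M,N)$-invariant means, and they are, respectively, the smallest and the greatest $(M,N)$-invariant means; that is, every $(M,N)$-invariant mean $K\colon I^2\to I$ satisfies $\mathscr{L}(x,y)\le K(x,y)\le \mathscr{U}(x,y)$ for all $x,y\in I$.
   Context: A mean on an interval $I$ is a function $M\colon I^2\to I$ with $\min(x,y)\le M(x,y)\le\max(x,y)$ for all $x,y\in I$ (no continuity or symmetry is assumed). For means $M,N$ on $I$, a mean $K\colon I^2\to I$ is called $(M,N)$-invariant if $K(x,y)=K(M(x,y),N(x,y))$ for all $x,y\in I$. The sequences $(\min(x_n,y_n))_n$ and $(\max(x_n,y_n))_n$ are monotone and bounded, so the limits exist. *)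

(* Defs.v *)
From mathcomp Require Import all_boot all_order all_algebra.
From mathcomp Require Import all_classical all_reals all_analysis.

Set Implicit Arguments.
Unset Strict Implicit.
Unset Printing Implicit Defensive.

Import Order.TTheory GRing.Theory Num.Theory.
Import numFieldNormedType.Exports.

Local Open Scope classical_set_scope.
Local Open Scope ring_scope.

(* A function I^2 -> I is represented by a function R -> R -> R that maps     *)
(* I^2 into I; its values outside I^2 are irrelevant.                         *)
Definition is_mean (R : realType) (I : set R) (M : R -> R -> R) : Prop :=
  forall x y, I x -> I y ->
    I (M x y) /\ Num.min x y <= M x y <= Num.max x y.

Definition is_invariant_mean (R : realType) (I : set R) (M N K : R -> R -> R)
    : Prop :=
  is_mean I K /\ forall x y, I x -> I y -> K x y = K (M x y) (N x y).

(* mean_iter M N x y n is the pair (x_n, y_n).                                *)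
Definition mean_iter (R : realType) (M N : R -> R -> R) (x y : R) (n : nat)
    : R * R :=
  iter n (fun p => (M p.1 p.2, N p.1 p.2)) (x, y).

Definition min_iter (R : realType) (M N : R -> R -> R) (x y : R) (n : nat) : R :=
  Num.min (mean_iter M N x y n).1 (mean_iter M N x y n).2.

Definition max_iter (R : realType) (M N : R -> R -> R) (x y : R) (n : nat) : R :=
  Num.max (mean_iter M N x y n).1 (mean_iter M N x y n).2.

(* limn is a total operator; is_cvg_min_iter and is_cvg_max_iter below show   *)
(* that on I^2 the two limits exist.                                          *)
Definition lower_mean (R : realType) (M N : R -> R -> R) (x y : R) : R :=
  limn (min_iter M N x y).

Definition upper_mean (R : realType) (M N : R -> R -> R) (x y : R) : R :=
  limn (max_iter M N x y).

Lemma mean_iter_in (R : realType) (I : set R) (M N : R -> R -> R) (x y : R)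
    (n : nat) : is_mean I M -> is_mean I N -> I x -> I y ->
  I (mean_iter M N x y n).1 /\ I (mean_iter M N x y n).2.
Proof.
move=> hM hN Ix Iy; elim: n => [|n [I1 I2]] //=.
by split; [case: (hM _ _ I1 I2) | case: (hN _ _ I1 I2)].
Qed.

Lemma nondecreasing_min_iter (R : realType) (I : set R) (M N : R -> R -> R)
    (x y : R) : is_mean I M -> is_mean I N -> I x -> I y ->
  nondecreasing_seq (min_iter M N x y).
Proof.
move=> hM hN Ix Iy; apply/nondecreasing_seqP => n.
have [I1 I2] := mean_iter_in n hM hN Ix Iy.
have [_ /andP[m1 _]] := hM _ _ I1 I2.
have [_ /andP[m2 _]] := hN _ _ I1 I2.
by rewrite {2}/min_iter /= le_min m1 m2.
Qed.

Lemma nonincreasing_max_iter (R : realType) (I : set R) (M N : R -> R -> R)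
    (x y : R) : is_mean I M -> is_mean I N -> I x -> I y ->
  nonincreasing_seq (max_iter M N x y).
Proof.
move=> hM hN Ix Iy; apply/nonincreasing_seqP => n.
have [I1 I2] := mean_iter_in n hM hN Ix Iy.
have [_ /andP[_ m1]] := hM _ _ I1 I2.
have [_ /andP[_ m2]] := hN _ _ I1 I2.
by rewrite {1}/max_iter /= ge_max m1 m2.
Qed.

Lemma min_iter_le_max_iter (R : realType) (M N : R -> R -> R) (x y : R)
  (n : nat) : min_iter M N x y n <= max_iter M N x y n.
Proof. by rewrite /min_iter /max_iter ge_min le_max lexx. Qed.

Lemma is_cvg_min_iter (R : realType) (I : set R) (M N : R -> R -> R)
    (x y : R) : is_mean I M -> is_mean I N -> I x -> I y ->
  cvgn (min_iter M N x y).
Proof.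
move=> hM hN Ix Iy; apply: nondecreasing_is_cvgn.
  exact: (nondecreasing_min_iter hM hN).
exists (max_iter M N x y 0) => _ [n _ <-].
apply: (le_trans (min_iter_le_max_iter M N x y n)).
exact: (nonincreasing_max_iter hM hN Ix Iy).
Qed.

Lemma is_cvg_max_iter (R : realType) (I : set R) (M N : R -> R -> R)
    (x y : R) : is_mean I M -> is_mean I N -> I x -> I y ->
  cvgn (max_iter M N x y).
Proof.
move=> hM hN Ix Iy; apply: nonincreasing_is_cvgn.
  exact: (nonincreasing_max_iter hM hN).
exists (min_iter M N x y 0) => _ [n _ <-].
apply: le_trans (min_iter_le_max_iter M N x y n).
exact: (nondecreasing_min_iter hM hN Ix Iy).
Qed.

(* Main.v *)
Require Import Defs.
From mathcomp Require Import all_boot all_order all_algebra.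
From mathcomp Require Import all_classical all_reals all_analysis.

Set Implicit Arguments.
Unset Strict Implicit.

Import Order.TTheory GRing.Theory Num.Theory.
Import numFieldNormedType.Exports.

Local Open Scope classical_set_scope.
Local Open Scope ring_scope.

(** Each interval [min(x_n, y_n), max(x_n, y_n)] contains the next one, so the
    limits of its endpoints satisfy
      min(x, y) <= lower_mean <= upper_mean <= max(x, y)
    ([lower_upper_mean_bounds]); hence both limits are means, with values in I
    because I is an interval.  Starting from (M(x, y), N(x, y)) instead of
    (x, y) only drops the first term of the sequence, and that does not change
    a limit; this is invariance ([lower_mean_invariant],
    [upper_mean_invariant]).  Finally, an invariant mean K is constant along
    the orbit ([invariant_mean_iter]), so K(x, y) = K(x_n, y_n) lies between
    min(x_n, y_n) and max(x_n, y_n) for every n, and therefore between the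
    limits. *)

Lemma mean_iter_shift (R : realType) (M N : R -> R -> R) (x y : R) (n : nat) :
  mean_iter M N (M x y) (N x y) n = mean_iter M N x y n.+1.
Proof. by rewrite /mean_iter iterSr. Qed.

Lemma limn_shiftS (R : realType) (u : R^nat) : cvgn u ->
  limn (fun n => u n.+1) = limn u.
Proof. by move=> cu; apply: cvg_lim => //; rewrite cvg_shiftS. Qed.

Lemma lower_mean_invariant (R : realType) (I : set R) (M N : R -> R -> R)
    (x y : R) : is_mean I M -> is_mean I N -> I x -> I y ->
  lower_mean M N x y = lower_mean M N (M x y) (N x y).
Proof.
move=> hM hN Ix Iy.
rewrite /lower_mean -(limn_shiftS (u := min_iter M N x y)).
  by congr (limn _); apply/funext => n; rewrite /min_iter mean_iter_shift.
exact: (is_cvg_min_iter hM hN).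
Qed.

Lemma upper_mean_invariant (R : realType) (I : set R) (M N : R -> R -> R)
    (x y : R) : is_mean I M -> is_mean I N -> I x -> I y ->
  upper_mean M N x y = upper_mean M N (M x y) (N x y).
Proof.
move=> hM hN Ix Iy.
rewrite /upper_mean -(limn_shiftS (u := max_iter M N x y)).
  by congr (limn _); apply/funext => n; rewrite /max_iter mean_iter_shift.
exact: (is_cvg_max_iter hM hN).
Qed.

(** Taking n = 0 in the monotone sequences gives the two outer bounds. *)
Lemma lower_upper_mean_bounds (R : realType) (I : set R) (M N : R -> R -> R)
    (x y : R) : is_mean I M -> is_mean I N -> I x -> I y ->
  [/\ Num.min x y <= lower_mean M N x y,
      lower_mean M N x y <= upper_mean M N x y &
      upper_mean M N x y <= Num.max x y].
Proof.
move=> hM hN Ix Iy.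
have cmin := is_cvg_min_iter hM hN Ix Iy.
have cmax := is_cvg_max_iter hM hN Ix Iy.
split.
- exact: (nondecreasing_cvgn_le (nondecreasing_min_iter hM hN Ix Iy) cmin 0).
- by apply: ler_lim => //; near=> n; exact: min_iter_le_max_iter.
- exact: (nonincreasing_cvgn_ge (nonincreasing_max_iter hM hN Ix Iy) cmax 0).
Unshelve. all: by end_near. Qed.

Lemma min_max_interval (R : realType) (I : set R) (x y z : R) :
  is_interval I -> I x -> I y -> Num.min x y <= z <= Num.max x y -> I z.
Proof.
move=> hI Ix Iy; apply: hI; first by rewrite minEle; case: ifP.
by rewrite maxEle; case: ifP.
Qed.

(** Here the n-th pair must lie in I^2 before the invariance of K applies to
    it: K satisfies the equation on I^2 only. *)
Lemma invariant_mean_iter (R : realType) (I : set R) (M N K : R -> R -> R)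
    (x y : R) (n : nat) : is_mean I M -> is_mean I N ->
  is_invariant_mean I M N K -> I x -> I y ->
  K (mean_iter M N x y n).1 (mean_iter M N x y n).2 = K x y.
Proof.
move=> hM hN [_ invK] Ix Iy; elim: n => //= n <-.
by have [I1 I2] := mean_iter_in n hM hN Ix Iy; rewrite -invK.
Qed.

Lemma invariant_mean_iter_bounds (R : realType) (I : set R)
    (M N K : R -> R -> R) (x y : R) (n : nat) : is_mean I M -> is_mean I N ->
  is_invariant_mean I M N K -> I x -> I y ->
  min_iter M N x y n <= K x y <= max_iter M N x y n.
Proof.
move=> hM hN hK Ix Iy.
rewrite -(invariant_mean_iter n hM hN hK Ix Iy).
have [I1 I2] := mean_iter_in n hM hN Ix Iy.
by have [_] := hK.1 _ _ I1 I2.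
Qed.

Unset Implicit Arguments.
Set Strict Implicit.

Theorem mainTheorem1 (R : realType) (I : set R) (hI : is_interval I)
    (M N : R -> R -> R) (hM : is_mean I M) (hN : is_mean I N) :
  is_invariant_mean I M N (lower_mean M N) /\
  is_invariant_mean I M N (upper_mean M N) /\
  (forall K : R -> R -> R, is_invariant_mean I M N K ->
    forall x y : R, I x -> I y ->
      lower_mean M N x y <= K x y <= upper_mean M N x y).
Proof.
split; last split.
- split=> x y Ix Iy; last exact: (lower_mean_invariant hM hN).
  have [minL LU Umax] := lower_upper_mean_bounds hM hN Ix Iy.
  have bL : Num.min x y <= lower_mean M N x y <= Num.max x y.
    by rewrite minL (le_trans LU).
  by split=> //; exact: min_max_interval bL.
- split=> x y Ix Iy; last exact: (upper_mean_invariant hM hN).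
  have [minL LU Umax] := lower_upper_mean_bounds hM hN Ix Iy.
  have bU : Num.min x y <= upper_mean M N x y <= Num.max x y.
    by rewrite Umax (le_trans minL).
  by split=> //; exact: min_max_interval bU.
move=> K hK x y Ix Iy.
have bK n := invariant_mean_iter_bounds n hM hN hK Ix Iy.
apply/andP; split.
- apply: limr_le; first exact: (is_cvg_min_iter hM hN).
  by near=> n; have /andP[] := bK n.
- apply: limr_ge; first exact: (is_cvg_max_iter hM hN).
  by near=> n; have /andP[] := bK n.
Unshelve. all: by end_near. Qed.
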